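(* Let $W$ be a finite group acting orthogonally on a Euclidean vector space $\mathfrak{t}$, preserving a lattice $\Gamma$ in $\mathfrak{t}$, and let $w\in W$. Then the dual component group $F_w^\vee$ is (canonically) isomorphic to the Pontryagin dual $\widehat{F_w}$ of $F_w$. Therefore $F_w^\vee$ is (non-canonically) isomorphic to $F_w$.
   Context: $\mathfrak{t}$ is a finite-dimensional real inner product space and $\Gamma$ is a full-rank lattice in it. The dual lattice is $\Gamma^\vee=\{x\in\mathfrak{t} : \langle x,y\rangle\in\mathbb{Z}\ \text{for all } y\in\Gamma\}$, where the inner product is used to identify $\mathfrak{t}^*$ with $\mathfrak{t}$ ($W$-equivariantly); $\Gamma^\vee$ is preserved by $W$. Let $\mathcal{T}=\mathfrak{t}/\Gamma$ and $\mathcal{T}^\vee=\mathfrak{t}/\Gamma^\vee$, with the induced $W$-actions. For $w\in W$, $\mathcal{T}^w$ and $(\mathcal{T}^\vee)^w$ denote the subgroups of points fixed by $w$, and $\mathcal{T}^w_1$, $(\mathcal{T}^\vee)^w_1$ their identity components. The component groups are the finite abelian groups $F_w=\mathcal{T}^w/\mathcal{T}^w_1$ and $F_w^\vee=(\mathcal{T}^\vee)^w/(\mathcal{T}^\vee)^w_1$. The canonical isomorphism is the following one. Let $\mathfrak{t}^w=\ker(I-w)$ and $\mathfrak{x}_w=(\mathfrak{t}^w)^\perp$. Restricting the characters $\chi_x(y+\Gamma)=e^{2\pi i\langle x,y\rangle}$, $x\in\Gamma^\vee$, of $\mathcal{T}$ identifies $\widehat{F_w}$ with $(\mathfrak{x}_w\cap\Gamma^\vee)/(I-w)\Gamma^\vee$;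 likewise $\widehat{F_w^\vee}$ is identified with $(\mathfrak{x}_w\cap\Gamma)/(I-w)\Gamma$. Let $m$ be the minimal polynomial of $w$ on $\mathfrak{t}$, $\dot m(t)=\frac{m(t)-m(1)}{t-1}$, and, when $m(1)=0$, $\ddot m(t)=\frac{\dot m(t)-\dot m(1)}{t-1}$. Put $\overline m=\dot m$, $\mu=m(1)$ if $m(1)\ne0$, and $\overline m=\ddot m$, $\mu=\dot m(1)$ if $m(1)=0$. The pairing of $\widehat{F_w}$ with $\widehat{F_w^\vee}$ is $\chi(x+(I-w)\Gamma^\vee,\,y+(I-w)\Gamma)=e^{\frac{2\pi i}{\mu}\langle x,\overline m(w)y\rangle}$, with values in the unit circle, and the canonical isomorphism is $F_w^\vee\cong\widehat{\widehat{F_w^\vee}}\cong\widehat{F_w}$, where the first map is evaluation and the second is induced by $\chi$. *)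

(* Defs.v *)
From HB Require Import structures.
From mathcomp Require Import all_boot all_order all_fingroup all_algebra
  generic_quotient.
From mathcomp Require Import all_classical all_reals topology trigo.
From mathcomp Require Import complex.
Set Implicit Arguments.
Unset Strict Implicit.
Unset Printing Implicit Defensive.
Import Order.TTheory GRing.Theory Num.Theory.
Local Open Scope classical_set_scope.
Local Open Scope ring_scope.
Local Open Scope quotient_scope.

(* e2pi a = exp (2 pi i a) *)
Definition e2pi (R : realType) (a : R) : R[i] :=
  Complex (cos (2 * pi * a)) (sin (2 * pi * a)).

(* The Pontryagin dual of an abelian group with the discrete topology: all
   homomorphisms to the unit circle. The group law, pointwise multiplication,
   is written additively so that homomorphisms into and out of it are
   {additive _ -> _}. *)
Section PontryaginDual.
Variables (R : realType) (A : zmodType).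

Record pdual := Character {
  char_fun :> A -> R[i];
  char_norm1 : forall a, `|char_fun a| = 1;
  charD : {morph char_fun : a b / a + b >-> a * b} }.

Lemma pdualP (f g : pdual) : f =1 g -> f = g.
Proof.
case: f g => [f f1 fD] [g g1 gD] /= /funext fg.
by case: _ / fg in g1 gD *; congr Character; exact: Prop_irrelevance.
Qed.

HB.instance Definition _ := gen_eqMixin pdual.
HB.instance Definition _ := gen_choiceMixin pdual.

Lemma char_neq0 (f : pdual) a : f a != 0.
Proof. by rewrite -normr_eq0 char_norm1 oner_eq0. Qed.

Lemma char0_norm1 (a : A) : `|1 : R[i]| = 1. Proof. exact: normr1. Qed.
Lemma char0D : {morph (fun=> 1 : R[i]) : a b / (a + b : A) >-> a * b}.
Proof. by move=> a b; rewrite mulr1. Qed.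
Definition char0 : pdual := Character char0_norm1 char0D.

Lemma char_opp_norm1 (f : pdual) a : `|(f a)^-1| = 1.
Proof. by rewrite normfV char_norm1 invr1. Qed.
Lemma char_oppD (f : pdual) :
  {morph (fun a => (f a)^-1) : a b / a + b >-> a * b}.
Proof. by move=> a b; rewrite charD invfM. Qed.
Definition char_opp f : pdual := Character (char_opp_norm1 f) (@char_oppD f).

Lemma char_add_norm1 (f g : pdual) a : `|f a * g a| = 1.
Proof. by rewrite normrM !char_norm1 mulr1. Qed.
Lemma char_addD (f g : pdual) :
  {morph (fun a => f a * g a) : a b / a + b >-> a * b}.
Proof. by move=> a b; rewrite !charD mulrACA. Qed.
Definition char_add f g : pdual :=
  Character (char_add_norm1 f g) (@char_addD f g).

Lemma char_addA : associative char_add.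
Proof. by move=> f g h; apply: pdualP => a /=; rewrite mulrA. Qed.
Lemma char_addC : commutative char_add.
Proof. by move=> f g; apply: pdualP => a /=; rewrite mulrC. Qed.
Lemma char_add0 : left_id char0 char_add.
Proof. by move=> f; apply: pdualP => a /=; rewrite mul1r. Qed.
Lemma char_addN : left_inverse char0 char_opp char_add.
Proof. by move=> f; apply: pdualP => a /=; rewrite mulVf ?char_neq0. Qed.

HB.instance Definition _ :=
  GRing.isZmodule.Build pdual char_addA char_addC char_add0 char_addN.
End PontryaginDual.

Definition ev_char (R : realType) (A : zmodType) (a : A) : pdual R (pdual R A) :=
  @Character R (pdual R A) (fun f => f a)
    (fun f => char_norm1 f a) (fun f g => erefl).

(* The minimal polynomial of an endomorphism (which is 1 on the zero space). *)
Section MinimalPolynomial.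
Import vector.VectorInternalTheory.
Variables (K : fieldType) (V : vectType K).

Definition poly_lfun (p : {poly K}) (f : 'End(V)) (v : V) : V :=
  \sum_(i < size p) p`_i *: iter i f v.

Definition is_minpoly (f : 'End(V)) (m : {poly K}) : Prop :=
  [/\ m \is monic, forall v, poly_lfun m f v = 0
    & forall p, (forall v, poly_lfun p f v = 0) -> m %| p].

Definition lfun_minpoly (f : 'End(V)) : {poly K} := xget 0 (is_minpoly f).

Lemma v2r_poly_lfun (p : {poly K}) (f : 'End(V)) v :
  v2r (poly_lfun p f v) =
  \sum_(i < size p) p`_i *: iter i (mulmx^~ (f2mx f)) (v2r v).
Proof.
rewrite linear_sum; apply: eq_bigr => i _; rewrite linearZ; congr (_ *: _).
by elim: (i : nat) => //= k <-; rewrite unlock /= r2vK.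
Qed.

Lemma mx_minpoly_exists n (A : 'M[K]_n) : exists m : {poly K},
  [/\ m \is monic,
      forall u : 'rV_n, \sum_(i < size m) m`_i *: iter i (mulmx^~ A) u = 0
    & forall p : {poly K}, (forall u : 'rV_n,
        \sum_(i < size p) p`_i *: iter i (mulmx^~ A) u = 0) -> m %| p].
Proof.
case: n A => [|n] A.
  by exists 1; split=> [|u|p _]; rewrite ?monic1 ?dvd1p// [LHS]thinmx0.
have hornerE (p : {poly K}) (u : 'rV_n.+1) :
    \sum_(i < size p) p`_i *: iter i (mulmx^~ A) u = u *m horner_mx A p.
  rewrite /horner_mx /horner_morph horner_coef mulmx_sumr.
  rewrite size_map_inj_poly ?raddf0//; last exact: fmorph_inj.
  apply: eq_bigr => i _; rewrite coef_map /=.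
  rewrite -mulmxE mul_scalar_mx -scalemxAr; congr (_ *: _).
  elim: (i : nat) => [|k IH] /=; first by rewrite expr0 mulmx1.
  by rewrite IH exprSr -mulmxE mulmxA.
exists (mxminpoly A); split=> [|u|p pA]; first exact: mxminpoly_monic.
  by rewrite hornerE mx_root_minpoly mulmx0.
apply: mxminpoly_min; apply/row_matrixP => i.
by rewrite rowE -hornerE pA row0.
Qed.

Lemma lfun_minpolyP f : is_minpoly f (lfun_minpoly f).
Proof.
rewrite /lfun_minpoly; case: xgetP => // /(_ _) nom; exfalso.
have [m [m1 mf mmin]] := mx_minpoly_exists (f2mx f).
apply: (nom m); split=> // [v|p pf].
  by apply: (can_inj v2rK); rewrite v2r_poly_lfun mf linear0.
by apply: mmin => u; rewrite -[u]r2vK -v2r_poly_lfun pf linear0.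
Qed.
End MinimalPolynomial.

(* (p(t) - p(1)) / (t - 1) *)
Definition poly_dot (K : fieldType) (p : {poly K}) : {poly K} :=
  (p - p.[1]%:P) %/ ('X - 1%:P).

Section Euclid.
Variables (R : realType) (t : vectType R).

(* The space t with the topology of the norm attached to ip. *)
Definition euclid (ip : {dot t for idfun}) : Type := t.

Variable ip : {dot t for idfun}.

HB.instance Definition _ := GRing.Zmodule.on (euclid ip).

Definition euclid_open : set_system (euclid ip) :=
  [set A | forall x : t, A x ->
     exists2 e, 0 < e & forall y : t, ip (y - x) (y - x) < e -> A y].

Lemma euclid_openT : euclid_open setT.
Proof. by move=> x _; exists 1. Qed.

Lemma euclid_openI : setI_closed euclid_open.
Proof.
move=> A B oA oB x [/oA[e e0 eA] /oB[d d0 dB]].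
exists (Order.min e d) => [|y]; first by rewrite lt_min e0.
by rewrite lt_min => /andP[/eA ? /dB].
Qed.

Lemma euclid_open_bigU (I : Type) (f : I -> set (euclid ip)) :
  (forall i, euclid_open (f i)) -> euclid_open (\bigcup_i f i).
Proof.
by move=> of_ x [i _ /of_[e e0 ef]]; exists e => // y /ef fy; exists i.
Qed.

HB.instance Definition _ := isOpenTopological.Build (euclid ip)
  euclid_openT euclid_openI euclid_open_bigU.

(* A full-rank lattice is the Z-span of a basis. *)
Definition is_lattice (L : {pred t}) : Prop :=
  exists2 b : (\dim {:t}).-tuple t, basis_of fullv b &
    forall x, x \in L <-> exists c : 'I_(\dim {:t}) -> int,
      x = \sum_i tnth b i *~ c i.

Definition in_dual_lattice (L : zmodClosed t) : {pred t} :=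
  fun x => `[< forall y, y \in L -> ip x y \is a Num.int >].

Lemma in_dual_lattice_zmod (L : zmodClosed t) : zmod_closed (in_dual_lattice L).
Proof.
split=> [|x y].
  by apply/asboolP => y _; rewrite linear0l rpred0.
move=> /asboolP xL /asboolP yL; apply/asboolP => z zL.
by rewrite linearBl rpredB ?xL ?yL.
Qed.

Definition dual_lattice (L : zmodClosed t) : zmodClosed t :=
  HB.pack (in_dual_lattice L)
    (GRing.isZmodClosed.Build t _ (in_dual_lattice_zmod L)).

(* t / L, as a group and as a topological quotient of euclid d *)
Definition torus (d : {dot t for idfun}) (L : zmodClosed t) : Type :=
  quotient_topology ({ideal_quot L} : quotType (euclid d)).
HB.instance Definition _ L := Topological.on (torus ip L).
HB.instance Definition _ L := Quotient.copy (torus ip L) {ideal_quot L}.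
HB.instance Definition _ L := GRing.isZmodule.Build (torus ip L)
  (@Quotient.addqA t L) (@Quotient.addqC t L) (@Quotient.add0q t L)
  (@Quotient.addNq t L).

Lemma torus_eqP (L : zmodClosed t) (x y : t) :
  reflect (\pi_(torus ip L) x = \pi_(torus ip L) y) (x - y \in L).
Proof. by rewrite Quotient.idealrBE; apply: (iffP eqP). Qed.

Lemma torus_piB (L : zmodClosed t) (x y : t) :
  \pi_(torus ip L) (x - y) = \pi_(torus ip L) x - \pi_(torus ip L) y.
Proof.
exact: (raddfB (\pi_{ideal_quot L} : {additive t -> {ideal_quot L}})).
Qed.

Lemma torus_subr_continuous (L : zmodClosed t) (Y : torus ip L) :
  continuous (fun X : torus ip L => X - Y).
Proof.
rewrite -[Y]reprK; move: (repr Y) => y.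
apply/continuousP => A oA.
have {}oA : euclid_open (\pi_(torus ip L) @^-1` A : set (euclid ip)) := oA.
suff: euclid_open [set x : euclid ip | A (\pi x - \pi_(torus ip L) y)] by [].
move=> x /=; rewrite -torus_piB => Ax.
have [e e0 eA] := oA _ Ax; exists e => // z zx.
by rewrite -torus_piB; apply: eA; rewrite opprB addrA subrK.
Qed.

Record lattice_action (L : zmodClosed t) (W : finGroupType) := LatticeAction {
  act :> W -> 'End(t);
  act1 : act 1%g = \1%VF;
  actM : forall g h, act (g * h)%g = (act g \o act h)%VF;
  act_isometry : forall g, isometry ip ip (act g);
  act_lattice : forall g, {in L, forall x, act g x \in L} }.

End Euclid.

Section DualAction.
Variables (R : realType) (t : vectType R) (ip : {dot t for idfun}).
Variables (L : zmodClosed t) (W : finGroupType) (rho : lattice_action ip L W).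

Lemma act_dual_lattice g :
  {in dual_lattice ip L, forall x, rho g x \in dual_lattice ip L}.
Proof.
move=> x /asboolP xL; apply/asboolP => y yL.
have -> : y = rho g (rho g^-1%g y).
  by rewrite -comp_lfunE -actM mulgV act1 id_lfunE.
by rewrite act_isometry xL ?act_lattice.
Qed.

(* W acts in the same way on t, but the torus is now t / L^vee. *)
Definition dual_action : lattice_action ip (dual_lattice ip L) W :=
  LatticeAction (act1 rho) (actM rho) (act_isometry rho) act_dual_lattice.
End DualAction.

Section ComponentGroup.
Variables (R : realType) (t : vectType R) (ip : {dot t for idfun}).
Variables (L : zmodClosed t) (W : finGroupType) (rho : lattice_action ip L W).
Variable w : W.
Local Notation T := (torus ip L).

Definition torus_act (X : T) : T := \pi_T (rho w (repr X)).

Lemma torus_actE (x : t) : torus_act (\pi_T x) = \pi_T (rho w x).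
Proof.
apply/torus_eqP; rewrite -linearB act_lattice//.
by apply/(torus_eqP ip); rewrite reprK.
Qed.

Lemma torus_actB : {morph torus_act : X Y / X - Y}.
Proof.
move=> X Y; rewrite -[X]reprK -[Y]reprK; move: (repr X) (repr Y) => x y.
by rewrite -torus_piB !torus_actE linearB torus_piB.
Qed.

Definition is_fixed : {pred T} := fun X => torus_act X == X.

Lemma is_fixedP X : reflect (torus_act X = X) (X \in is_fixed).
Proof. exact: eqP. Qed.

Lemma is_fixed_zmod : zmod_closed is_fixed.
Proof.
split=> [|X Y /is_fixedP fX /is_fixedP fY]; apply/is_fixedP.
  by rewrite -[in LHS](subrr 0) torus_actB subrr.
by rewrite torus_actB fX fY.
Qed.

Definition fixed : zmodClosed T :=
  HB.pack is_fixed (GRing.isZmodClosed.Build T _ is_fixed_zmod).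

Definition fixed_torus : Type := {X : T | X \in fixed}.
HB.instance Definition _ := [isSub of fixed_torus for @sval T _].
HB.instance Definition _ := [Choice of fixed_torus by <:].
HB.instance Definition _ := [SubChoice_isSubZmodule of fixed_torus by <:].

Definition in_identity_component : {pred fixed_torus} := fun X =>
  `[< connected_component [set Y : T | Y \in fixed] 0 (val X) >].

Lemma in_identity_component_zmod : zmod_closed in_identity_component.
Proof.
have A0 : [set Y : T | Y \in fixed] 0 by exact: (rpred0 fixed).
split=> [|X Y /asboolP cX /asboolP cY]; apply/asboolP.
  exact: connected_component_refl.
rewrite [val _](raddfB (val : {additive fixed_torus -> T})).
pose f (Z : T) := Z - val Y.
set C := connected_component _ _ in cX cY *.
suff fC : f @` C `<=` C by apply: fC; exists (val X).
apply: connected_component_max.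
- by exists (val Y) => //; rewrite /f subrr.
- move=> _ [Z cZ <-]; apply: (rpredB (connected_component_sub cZ)).
  exact: valP.
- apply: connected_continuous_connected; first exact: component_connected.
  exact/continuous_subspaceT/torus_subr_continuous.
Qed.

Definition identity_component : zmodClosed fixed_torus :=
  HB.pack in_identity_component
    (GRing.isZmodClosed.Build fixed_torus _ in_identity_component_zmod).

Definition comp_group : zmodType := {ideal_quot identity_component}.

(* x_w, the orthogonal complement of the fixed space of w *)
Definition moved_space : {vspace t} := orthov ip (lker (\1 - rho w)%VF).

(* lam is the character of the component group through which the restriction
   to the fixed points of the character y + L |-> exp (2 pi i <x, y>) of the
   torus factors. *)
Definition restricts_to (x : t) (lam : pdual R comp_group) : Prop :=
  forall (X : fixed_torus) (y : t), \pi_T y = val X ->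
    lam (\pi_comp_group X) = e2pi (ip x y).

(* Restricting characters identifies the dual of the component group with
   (x_w `&` M) / (1 - w) M, where M is the lattice dual to L. *)
Definition restriction_identifies (M : {pred t}) : Prop :=
  [/\ forall x, x \in moved_space -> x \in M ->
        exists lam, restricts_to x lam,
      forall lam, exists x,
        [/\ x \in moved_space, x \in M & restricts_to x lam]
    & forall x, x \in moved_space -> x \in M ->
        restricts_to x 0 <-> exists2 y, y \in M & x = y - rho w y].
End ComponentGroup.

Section Pairing.
Variables (R : realType) (t : vectType R) (ip : {dot t for idfun}).
Variables (L : zmodClosed t) (W : finGroupType) (rho : lattice_action ip L W).
Variable w : W.

Definition pairing_poly : {poly R} :=
  let m := lfun_minpoly (rho w) in
  if m.[1] == 0 then poly_dot (poly_dot m) else poly_dot m.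

Definition pairing_scale : R :=
  let m := lfun_minpoly (rho w) in
  if m.[1] == 0 then (poly_dot m).[1] else m.[1].

(* Characters of the dual component group are restrictions of characters of
   t / L^vee, hence are indexed by vectors of L itself. *)
Definition is_component_pairing
    (chi : pdual R (comp_group rho w) ->
           pdual R (pdual R (comp_group (dual_action rho) w))) : Prop :=
  forall (x y : t) (lam : pdual R (comp_group rho w))
    (psi : pdual R (comp_group (dual_action rho) w)),
  x \in moved_space rho w -> x \in dual_lattice ip L ->
  y \in moved_space rho w -> y \in L ->
  restricts_to x lam -> restricts_to y psi ->
  chi lam psi =
    e2pi (pairing_scale^-1 * ip x (poly_lfun pairing_poly (rho w) y)).
End Pairing.

(* Main.v *)
From HB Require Import structures.
From mathcomp Require Import all_boot all_order all_fingroup all_algebra.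
From mathcomp Require Import generic_quotient.
From mathcomp Require Import all_classical all_reals topology normedtype trigo.
From mathcomp Require Import complex ring lra.
Require Import Defs.
Set Implicit Arguments.
Unset Strict Implicit.
Unset Printing Implicit Defensive.
Import Order.TTheory GRing.Theory Num.Theory.
Import numFieldNormedType.Exports.
Local Open Scope classical_set_scope.
Local Open Scope ring_scope.
Local Open Scope quotient_scope.

(** Write [g] for the action of [w], [L] for the lattice, [L^] for its dual,
    and [x_w] for the orthogonal complement of the fixed space of [g], which
    is also the image of [1 - g].

    The vectors lying over the fixed points of the torus are the [y] with
    [(1 - g) y] in [L], and the identity component is the image of the fixed
    space of [g] ([identity_componentP]). So sending the class of [y] to
    [(1 - g) y] identifies the component group with
    [(x_w `&` L) / (1 - g) L]. By the restriction of characters this is also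
    the dual of the dual component group: the point [y] of the component group
    corresponds to the character attached to [(1 - g) y]. This correspondence
    is the map [kappa] of [component_duality]. On [x_w] the operator
    [pairing_scale^-1 *: pairing_poly(g)] is the inverse of [1 - g]
    ([pairing_inverse]), hence the pairing chi is evaluation transported along
    [kappa], that is, chi is the transpose of the isomorphism [kappa]. The
    character sent by chi to the evaluation at the class of [v] is the one
    attached to [(1 - g^-1) v], because [1 - g^-1] is the adjoint of [1 - g].

    What remains is concrete once [1 - g] is diagonalised over the integers:
    the Smith normal form gives two bases [e] and [f] of [L] with
    [(1 - g) e_i = d_i f_i] ([adapted_bases_exist]). In the coordinates [y_i]
    along [e], the fixed points of the torus are the [y] with all
    [d_i y_i] integral, and the identity component consists of those with
    [y_i] integral whenever [d_i] is nonzero. This yields the description of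
    the characters of the component group by restriction
    ([restriction_identifies_adapted]). The dual lattice has adapted bases with
    the same [d_i] ([adapted_bases_dual]), so everything holds for it too, and
    the linear map matching the two adapted bases induces an isomorphism
    between the two component groups ([comp_group_iso]). *)

(** * Characters of the circle *)

Section CircleCharacter.
Variable R : realType.
Implicit Types a b : R.

Lemma e2piD a b : e2pi (a + b) = e2pi a * e2pi b.
Proof.
rewrite /e2pi mulrDr cosD sinD; apply/eqP; rewrite eq_complex /=.
by rewrite eqxx/= addrC.
Qed.

Lemma e2pi_norm1 a : `|e2pi a| = 1.
Proof. by rewrite normc_def /= cos2Dsin2 sqrtr1. Qed.

Lemma e2pi0 : e2pi (0 : R) = 1.
Proof. by rewrite /e2pi mulr0 cos0 sin0. Qed.

Lemma e2piN a : e2pi (- a) = (e2pi a)^-1.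
Proof.
apply: (@mulfI _ (e2pi a)); first by rewrite -normr_eq0 e2pi_norm1 oner_eq0.
rewrite -e2piD subrr e2pi0 divff//.
by rewrite -normr_eq0 e2pi_norm1 oner_eq0.
Qed.

Lemma cos_int a : a \is a Num.int -> cos (2 * pi * a) = 1.
Proof.
move=> /intrP[k ->].
have cosn (n : nat) : cos (2 * pi * n%:R) = 1 :> R.
  rewrite [2 * pi]mulr_natl mulr_natr -[_ *+ n]add0r.
  by rewrite (periodicn (@cosD2pi R)) cos0.
case: k => n; first exact: cosn.
by rewrite NegzE intrN mulrN cosN cosn.
Qed.

(** After reducing modulo 1 and using the symmetry of cos, the injectivity of
    cos on half a period applies. *)
Lemma cos_eq1 a : cos (2 * pi * a) = 1 -> a \is a Num.int.
Proof.
have half (b : R) : 0 <= b <= 1 / 2 -> cos (2 * pi * b) = 1 -> b = 0.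
  move=> /andP[b0 b1] cb.
  have p0 := pi_gt0 R.
  have : 2 * pi * b = 0.
    by apply: cos_inj; rewrite ?cos0// in_itv/=; apply/andP; split; nra.
  by move=> /eqP; rewrite !mulf_eq0 pnatr_eq0 (gt_eqF p0)/= => /eqP.
have [k ak] : exists k : int, 0 <= a - k%:~R < 1.
  by exists (Num.floor a); have := floor_itv a; rewrite intrD; lra.
move=> ca; pose b := a - k%:~R; rewrite -/b in ak.
have cb : cos (2 * pi * b) = 1.
  rewrite mulrBr cosB ca mul1r cos_int ?intr_int//.
  have /cos1sin0 -> : `|cos (2 * pi * a)| = 1 by rewrite ca normr1.
  by rewrite mul0r addr0.
suff bi : b \is a Num.int by rewrite -[a](subrK k%:~R) rpredD ?intr_int.
have [b1|b1] := leP b (1 / 2).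
  by rewrite (half b) ?rpred0//; lra.
have c1b : cos (2 * pi * (1 - b)) = 1.
  rewrite mulrBr cosB cos_int ?rpred1// mul1r cb.
  have /cos1sin0 -> : `|cos (2 * pi * b)| = 1 by rewrite cb normr1.
  by rewrite mulr0 addr0.
have /half/(_ c1b) b1E : 0 <= 1 - b <= 1 / 2 by lra.
by rewrite (_ : b = 1) ?rpred1//; lra.
Qed.

Lemma e2pi_eq1 a : e2pi a = 1 <-> a \is a Num.int.
Proof.
split=> [[/cos_eq1//]|ai]; apply/eqP; rewrite eq_complex /= cos_int// eqxx/=.
by rewrite (@cos1sin0 _ (2 * pi * a))// cos_int// normr1.
Qed.

Lemma e2pi_eq a b : e2pi a = e2pi b <-> a - b \is a Num.int.
Proof.
have nz : e2pi b != 0 by rewrite -normr_eq0 e2pi_norm1 oner_eq0.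
rewrite -e2pi_eq1 e2piD e2piN.
by split=> [->|/(canRL (mulfVK nz))->]; rewrite ?mulfV ?mul1r.
Qed.

Lemma e2pi_surj (z : R[i]) : `|z| = 1 -> exists a, z = e2pi a.
Proof.
case: z => x y; rewrite normc_def/= => -[/(congr1 (fun r => r ^+ 2))].
rewrite sqr_sqrtr ?addr_ge0 ?sqr_ge0// expr1n => xy1.
have x1 : -1 <= x <= 1 by have := sqr_ge0 y; nra.
have p0 : 2 * pi != 0 :> R by rewrite mulf_neq0 ?pnatr_eq0// gt_eqF ?pi_gt0.
have xE : cos (acos x) = x by rewrite acosK// in_itv.
have sE : sin (acos x) = `|y|.
  by rewrite sin_acos// -xy1 addrAC subrr add0r sqrtr_sqr.
have [y0|y0] := leP 0 y.
  exists (acos x / (2 * pi)).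
  by rewrite /e2pi mulrCA divff// mulr1 xE sE ger0_norm.
exists (- (acos x / (2 * pi))).
by rewrite /e2pi mulrN cosN sinN mulrCA divff// mulr1 xE sE ltr0_norm// opprK.
Qed.

End CircleCharacter.

(** * Intervals contained in finite sets *)

(** Otherwise the interval would meet the gap between one of its points and the
    next value of [v]. *)
Lemma interval_finite_eq (R : realType) d (v : 'I_d -> R) (J : set R) :
  is_interval J -> (forall x, J x -> exists k, x = v k) ->
  forall a b, J a -> J b -> a = b.
Proof.
move=> itvJ fJ; suff lt0 a b : J a -> J b -> a < b -> False.
  move=> a b Ja Jb; case: (ltgtP a b) => // ab; exfalso.
    exact: (lt0 a b).
  exact: (lt0 b a).
move=> Ja Jb ab.
(* The smallest value of [v] above [a]: nothing in between is attained. *)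
pose m := \big[Order.min/b]_(k | a < v k) v k.
have am : a < m by rewrite /m; apply/bigmin_gtP; split.
have mb : m <= b by exact: bigmin_le_id.
have Jm : J ((a + m) / 2) by apply: (itvJ a b) => //; apply/andP; split; lra.
have [k kE] := fJ _ Jm.
have : m <= v k by apply: bigmin_le_cond; lra.
by rewrite -kE; lra.
Qed.

(** * Isomorphic quotients *)

(** The groups of this file are all quotients of subgroups [N] of the ambient
    space; two such presentations with the same kernel define isomorphic
    quotients. *)
Lemma induced_iso (V A B : zmodType) (N : zmodClosed V)
    (a : V -> A) (b : V -> B) :
  {in N &, {morph a : x y / x - y}} -> {in N &, {morph b : x y / x - y}} ->
  (forall X, exists2 x, x \in N & a x = X) ->
  (forall Y, exists2 x, x \in N & b x = Y) ->
  {in N, forall x, a x = 0 <-> b x = 0} ->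
  exists2 f : {additive A -> B}, bijective f & {in N, forall x, f (a x) = b x}.
Proof.
move=> aB bB a_surj b_surj ker_ab.
have eqab x y : x \in N -> y \in N -> a x = a y <-> b x = b y.
  move=> xN yN; have := ker_ab (x - y) (rpredB xN yN); rewrite aB// bB// => ker.
  by split=> /eqP; rewrite -subr_eq0 => /eqP/ker/eqP; rewrite subr_eq0 => /eqP.
pose s X := projT1 (cid2 (a_surj X)).
have sN X : s X \in N by rewrite /s; case: cid2.
have as_ X : a (s X) = X by rewrite /s; case: cid2.
pose f X := b (s X).
have fa x : x \in N -> f (a x) = b x.
  by move=> xN; apply/(eqab _ _ (sN _) xN); rewrite as_.
have fB : zmod_morphism f.
  move=> X Y; rewrite -[X in f (X - _)]as_ -[Y in f (_ - Y)]as_ -aB//.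
  by rewrite fa ?rpredB// bB.
pose F : {additive A -> B} := HB.pack f (GRing.isZmodMorphism.Build A B f fB).
exists F => //.
pose r Y := projT1 (cid2 (b_surj Y)).
have rN Y : r Y \in N by rewrite /r; case: cid2.
have br Y : b (r Y) = Y by rewrite /r; case: cid2.
exists (fun Y => a (r Y)) => [X|Y] /=; last by rewrite fa.
by rewrite -[RHS]as_; apply/eqab; rewrite ?br.
Qed.

(** * Dual bases and the Smith normal form of 1 - g *)

Section IntegerCombinations.
Variable V : zmodType.

Definition int_comb m n (P : 'M[int]_(m, n)) (b : 'I_n -> V) (i : 'I_m) : V :=
  \sum_j b j *~ P i j.

Lemma int_comb_mul m n p (P : 'M[int]_(m, n)) (Q : 'M_(n, p)) b :
  int_comb (P *m Q) b =1 int_comb P (int_comb Q b).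
Proof.
move=> i; rewrite /int_comb.
transitivity (\sum_j \sum_k b k *~ (Q j k * P i j)).
  rewrite exchange_big; apply: eq_bigr => k _.
  by rewrite mxE mulrz_sumr; apply: eq_bigr => j _; rewrite mulrC.
apply: eq_bigr => j _; rewrite mulrz_suml.
by apply: eq_bigr => k _; rewrite mulrzA.
Qed.

Lemma int_comb1 n (b : 'I_n -> V) : int_comb 1%:M b =1 b.
Proof.
move=> i; rewrite /int_comb (bigD1 i)//= mxE eqxx mulr1z big1 ?addr0// => j ji.
by rewrite mxE eq_sym (negPf ji) mulr0z.
Qed.

End IntegerCombinations.

Section DualBases.
Variables (R : realType) (t : vectType R) (ip : {dot t for idfun}).
Implicit Types (x y : t) (L M : {pred t}).

Lemma ipC x y : ip x y = ip y x.
Proof. by rewrite hermC expr0 mul1r. Qed.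

Lemma ip_eq0 x : ip x x = 0 -> x = 0.
Proof.
move=> x0; apply/eqP/negPn/negP => /(neq0_dnorm_gt0 (s := ip)).
by rewrite x0 ltxx.
Qed.

Lemma ip_sumr I (r : seq I) (P : pred I) (F : I -> t) x :
  ip x (\sum_(i <- r | P i) F i) = \sum_(i <- r | P i) ip x (F i).
Proof. exact: linear_sumr. Qed.

Lemma ip_suml I (r : seq I) (P : pred I) (F : I -> t) x :
  ip (\sum_(i <- r | P i) F i) x = \sum_(i <- r | P i) ip (F i) x.
Proof. exact: linear_sumlz. Qed.

Lemma ipZr a x y : ip x (a *: y) = a * ip x y.
Proof. exact: linearZr_LR. Qed.

Lemma ipZl a x y : ip (a *: x) y = a * ip x y.
Proof. exact: linearZl_LR. Qed.

Lemma ipBl x y z : ip (x - y) z = ip x z - ip y z.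
Proof. exact: linearBl. Qed.

Lemma ipBr x y z : ip x (y - z) = ip x y - ip x z.
Proof. exact: linearBr. Qed.

Lemma ipMzr k x y : ip x (y *~ k) = k%:~R * ip x y.
Proof. by rewrite -scaler_int ipZr. Qed.

(** The families [e] and [e'] are dual bases of the space, and the integral
    coordinate vectors along [e] and along [e'] form [L] and [M] respectively:
    [e] is a Z-basis of [L] and [e'] is the dual Z-basis of its dual [M]. In
    this form the definition is symmetric in [(L, e)] and [(M, e')], and
    membership in both lattices is read off coordinates. *)
Record dual_bases L M n (e e' : 'I_n -> t) : Prop := DualBases {
  dual_basesE : forall i j, ip (e i) (e' j) = (i == j)%:R;
  dual_bases_expand : forall x, x = \sum_i ip x (e' i) *: e i;
  dual_bases_L : forall x, x \in L <-> forall i, ip x (e' i) \is a Num.int;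
  dual_bases_M : forall x, x \in M <-> forall i, ip x (e i) \is a Num.int }.

Lemma dual_bases_sym L M n (e e' : 'I_n -> t) :
  dual_bases L M e e' -> dual_bases M L e' e.
Proof.
move=> [ee' xE xL xM]; split=> // [i j|x]; first by rewrite ipC ee' eq_sym.
apply/eqP; rewrite -subr_eq0; apply/eqP/ip_eq0.
set z := x - _; rewrite [z in ip _ z]xE ip_sumr big1// => i _.
rewrite ipZr (_ : ip z (e i) = 0) ?mulr0// linearBl/= ip_suml.
rewrite (bigD1 i)//= ipZl ipC ee' eqxx mulr1 ipC big1 ?addr0 ?subrr//.
by move=> j ji; rewrite ipZl ipC ee' eq_sym (negPf ji) mulr0.
Qed.

Lemma dual_bases_ip L M n (e e' : 'I_n -> t) : dual_bases L M e e' ->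
  forall x y, ip x y = \sum_i ip x (e i) * ip y (e' i).
Proof.
move=> ee' x y; rewrite {1}(dual_bases_expand ee' y) ip_sumr.
by apply: eq_bigr => i _; rewrite ipZr mulrC.
Qed.

Lemma dual_bases_coord L M n (e e' : 'I_n -> t) (c : 'I_n -> R) i :
  dual_bases L M e e' -> ip (\sum_j c j *: e j) (e' i) = c i.
Proof.
move=> ee'; rewrite ip_suml (bigD1 i)//= ipZl (dual_basesE ee') eqxx mulr1.
rewrite big1 ?addr0// => j ji.
by rewrite ipZl (dual_basesE ee') (negPf ji) mulr0.
Qed.

Lemma dual_bases_dual (L M : zmodClosed t) n (e e' : 'I_n -> t) :
  dual_bases L M e e' -> M =i dual_lattice ip L.
Proof.
move=> ee' x; apply/idP/asboolP => [xM y yL|xL].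
  rewrite (dual_bases_ip ee') rpred_sum// => i _; rewrite rpredM//.
    exact: (dual_bases_M ee' x).1.
  exact: (dual_bases_L ee' y).1.
apply/(dual_bases_M ee') => i; apply: xL; apply/(dual_bases_L ee') => j.
by rewrite (dual_basesE ee') rpred_nat.
Qed.

(** A change of basis that is invertible over the integers preserves the set of
    integral coordinate vectors; the dual family changes by the contragredient
    matrix. *)
Lemma dual_bases_unimodular L M n (b b' : 'I_n -> t) (P : 'M[int]_n) :
  dual_bases L M b b' -> P \in unitmx ->
  dual_bases L M (int_comb P b) (int_comb (invmx P)^T b').
Proof.
move=> [bb' xE xL xM] uP.
have ipcr (Q : 'M[int]_n) c x i :
    ip x (int_comb Q c i) = \sum_j (Q i j)%:~R * ip x (c j).
  by rewrite ip_sumr; apply: eq_bigr => j _; rewrite ipMzr.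
have ipP x i :
    ip x (b' i) = \sum_j (P j i)%:~R * ip x (int_comb (invmx P)^T b' j).
  rewrite -[b' i](int_comb1 b') -(trmx1 int n) -(mulVmx uP) trmx_mul.
  rewrite int_comb_mul ipcr.
  by apply: eq_bigr => j _; rewrite mxE.
have int_ip (Q Q' : 'M[int]_n) c x : Q *m Q' = 1%:M ->
    (forall i, ip x (c i) \is a Num.int) <->
    (forall i, ip x (int_comb Q' c i) \is a Num.int).
  move=> QQ'; split=> cx i.
    by rewrite ipcr rpred_sum// => j _; rewrite rpredM ?intr_int.
  rewrite -[c i](int_comb1 c) -QQ' int_comb_mul ipcr rpred_sum// => j _.
  by rewrite rpredM ?intr_int.
split=> [i j|x|x|x].
- rewrite ipcr.
  transitivity (((P *m invmx P) i j)%:~R : R); last first.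
    by rewrite mulmxV// mxE; case: eqP.
  rewrite mxE rmorph_sum /=; apply: eq_bigr => k _.
  rewrite mxE intrM mulrC ipC ipcr.
  congr (_ * _); rewrite (bigD1 k)//= ipC bb' eqxx mulr1 big1 ?addr0// => l lk.
  by rewrite ipC bb' (negPf lk) mulr0.
- rewrite {1}[x]xE; under eq_bigr => i _ do rewrite ipP scaler_suml.
  rewrite exchange_big; apply: eq_bigr => j _ /=.
  rewrite scaler_sumr; apply: eq_bigr => i _.
  by rewrite mulrC -scalerA scaler_int.
- apply: (iff_trans (xL x)); apply: (int_ip P^T).
  by rewrite -trmx_mul mulVmx// trmx1.
- by apply: (iff_trans (xM x)); apply: (int_ip (invmx P)); rewrite mulVmx.
Qed.

(** The Gram matrix of a basis is invertible because the inner product is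
    definite, and its inverse gives the dual basis. *)
Lemma lattice_dual_bases (L : zmodClosed t) : is_lattice L ->
  exists b b' : 'I_(\dim {:t}) -> t, dual_bases L (dual_lattice ip L) b b'.
Proof.
move=> [b bB bL].
pose G := \matrix_(i, j) ip (tnth b i) (tnth b j).
have freeb : free b := basis_free bB.
have uG : G \in unitmx.
  rewrite -row_free_unit; apply: inj_row_free => u uG0.
  pose v := \sum_i u 0 i *: tnth b i.
  have v0 : v = 0.
    apply: ip_eq0; rewrite {2}/v ip_sumr big1// => j _; rewrite ipZr.
    have := congr1 (fun m : 'rV_ _ => m 0 j) uG0; rewrite !mxE => uGj.
    rewrite (_ : ip v _ = 0) ?mulr0// -[RHS]uGj ip_suml.
    by apply: eq_bigr => i _; rewrite ipZl mxE.
  apply/rowP => i; rewrite [RHS]mxE.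
  have /(_ (fun j => u 0 j)) u0 := elimT freeP freeb.
  rewrite u0//; rewrite -[RHS]v0; apply: eq_bigr => j _; rewrite (tnth_nth 0)//.
pose b' i := \sum_j invmx G j i *: tnth b j.
have bb' i j : ip (tnth b i) (b' j) = (i == j)%:R.
  transitivity ((G *m invmx G) i j); last by rewrite mulmxV// mxE.
  by rewrite ip_sumr mxE; apply: eq_bigr => k _; rewrite ipZr !mxE mulrC.
have ipb' c i : ip (\sum_j c j *: tnth b j) (b' i) = c i.
  rewrite ip_suml (bigD1 i)//= ipZl bb' eqxx mulr1 big1 ?addr0// => j ji.
  by rewrite ipZl bb' (negPf ji) mulr0.
have xE x : x = \sum_i ip x (b' i) *: tnth b i.
  have xb : x \in <<b>>%VS by rewrite (span_basis bB) memvf.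
  rewrite {1}(coord_span xb); apply: eq_bigr => i _.
  rewrite [in RHS](coord_span xb) (tnth_nth 0); congr (_ *: _).
  under [X in ip X]eq_bigr => j _ do rewrite -tnth_nth.
  by rewrite ipb'.
have xL x : x \in L <-> forall i, ip x (b' i) \is a Num.int.
  rewrite bL; split=> [[c ->] i|ix].
    under eq_bigr => j _ do rewrite -scaler_int.
    by rewrite ipb' intr_int.
  exists (fun i => Num.floor (ip x (b' i))); rewrite {1}(xE x).
  by apply: eq_bigr => i _; rewrite -scaler_int floorK.
exists (tnth b), b'; split=> // x; split=> [/asboolP xM i|ix].
  by apply: xM; apply/xL => j; rewrite bb' rpred_nat.
apply/asboolP => y /xL iy; rewrite (xE y) ip_sumr rpred_sum// => i _.
by rewrite ipZr rpredM.
Qed.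

(** Bases in which [1 - g] is diagonal. There are two of them, because the
    Smith normal form changes the bases of source and target independently, so
    [d] does not consist of eigenvalues. *)
Record adapted_bases (g : 'End(t)) L M n (d : 'I_n -> int)
    (e f e' f' : 'I_n -> t) : Prop := AdaptedBases {
  adapted_ee' : dual_bases L M e e';
  adapted_ff' : dual_bases L M f f';
  adaptedE : forall i, e i - g (e i) = (d i)%:~R *: f i }.

(** If [A = P D Q] is the Smith normal form of the matrix of [1 - g] in a basis
    [b] of the lattice, then [P^-1 b] and [Q b] are adapted. *)
Lemma adapted_bases_exist (g : 'End(t)) (L : zmodClosed t) :
  is_lattice L -> {in L, forall x, g x \in L} ->
  exists n (d : 'I_n -> int) (e f e' f' : 'I_n -> t),
    adapted_bases g L (dual_lattice ip L) d e f e' f'.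
Proof.
move=> /lattice_dual_bases[b [b' bb']] gL.
have bL i : b i \in L.
  by apply/(dual_bases_L bb') => j; rewrite (dual_basesE bb') rpred_nat.
pose A := \matrix_(i, j) Num.floor (ip (b i - g (b i)) (b' j)).
have bA i : b i - g (b i) = int_comb A b i.
  rewrite {1}(dual_bases_expand bb' (b i - g (b i))); apply: eq_bigr => j _.
  rewrite mxE -scaler_int floorK//; move: j; apply/(dual_bases_L bb').
  by rewrite rpredB ?gL.
have [P uP [Q uQ [d _ AE]]] := int_Smith_normal_form A.
exists (\dim {:t}), (fun i => d`_i), (int_comb (invmx P) b), (int_comb Q b).
exists (int_comb (invmx (invmx P))^T b'), (int_comb (invmx Q)^T b').
split; [apply: dual_bases_unimodular|apply: dual_bases_unimodular|] => //.
  by rewrite unitmx_inv.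
move=> i.
have -> : int_comb (invmx P) b i - g (int_comb (invmx P) b i) =
    int_comb (invmx P) (int_comb A b) i.
  rewrite linear_sum -sumrB; apply: eq_bigr => j _.
  by rewrite -bA mulrzBl raddfMz.
rewrite -int_comb_mul AE -mulmxA mulKmx// int_comb_mul [LHS]/int_comb.
rewrite (bigD1 i)//= big1 => [|j ji].
  by rewrite addr0 mxE eqxx mulr1n scaler_int.
by rewrite mxE eq_sym [_ == _ :> nat](negPf ji) mulr0n mulr0z.
Qed.

End DualBases.

(** * Fixed points and moved vectors in adapted coordinates *)

Section AdaptedCoordinates.
Variables (R : realType) (t : vectType R) (ip : {dot t for idfun}).
Variables (L M : zmodClosed t) (W : finGroupType) (rho : lattice_action ip L W).
Variable w : W.
Local Notation g := (rho w).
Local Notation gV := (rho w^-1%g).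

Lemma actK x : gV (g x) = x.
Proof. by rewrite -comp_lfunE -actM mulVg act1 id_lfunE. Qed.

Lemma actVK x : g (gV x) = x.
Proof. by rewrite -comp_lfunE -actM mulgV act1 id_lfunE. Qed.

Lemma ip_act_adjoint x y : ip (g x) y = ip x (gV y).
Proof. by rewrite -{1}[y]actVK act_isometry. Qed.

Lemma ip_moved_adjoint x y : ip (x - g x) y = ip x (y - gV y).
Proof. by rewrite linearBl linearBr /= ip_act_adjoint. Qed.

Lemma act_fixedV x : g x = x <-> gV x = x.
Proof. by split=> [{1}<-|{1}<-]; rewrite ?actK ?actVK. Qed.

Lemma moved_spaceP x :
  x \in moved_space rho w <-> forall y, g y = y -> ip x y = 0.
Proof.
split=> [/mem_orthovP xm y gy|xm].
  apply: xm; rewrite memv_ker add_lfunE opp_lfunE id_lfunE gy subrr.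
  exact: eqxx.
apply/mem_orthovP => y; rewrite memv_ker add_lfunE opp_lfunE id_lfunE subr_eq0.
by move=> /eqP yE; apply: xm.
Qed.

Lemma moved_space_moved x : x - g x \in moved_space rho w.
Proof.
apply/moved_spaceP => y /act_fixedV gy.
by rewrite ip_moved_adjoint gy subrr linear0r.
Qed.

(** This shows that [1 - g] and [1 - g^-1] have the same image, on [t] and on
    every lattice stable under [g] and [g^-1]. *)
Lemma movedV x : x - gV x = - gV x - g (- gV x).
Proof. by rewrite linearN /= actVK opprK addrC. Qed.

Section Coordinates.
Variables (n : nat) (d : 'I_n -> int) (e f e' f' : 'I_n -> t).
Hypothesis adapted : adapted_bases ip g L M d e f e' f'.
Let ee' := adapted_ee' adapted.
Let ff' := adapted_ff' adapted.

Lemma adapted_coord y i : ip (y - g y) (f' i) = (d i)%:~R * ip y (e' i).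
Proof.
have -> : y - g y = \sum_j (ip y (e' j) * (d j)%:~R) *: f j.
  rewrite {1 2}(dual_bases_expand ee' y) linear_sum -sumrB.
  apply: eq_bigr => j _.
  by rewrite linearZ -scalerBr (adaptedE adapted) scalerA.
by rewrite (dual_bases_coord _ _ ff') mulrC.
Qed.

(** The adjoint of [1 - g] is [1 - g^-1], so it is diagonal, with the same
    entries, in the dual bases. *)
Lemma adapted_dual i : f' i - gV (f' i) = (d i)%:~R *: e' i.
Proof.
apply/eqP; rewrite -subr_eq0; apply/eqP/(@ip_eq0 _ _ ip).
set z := _ - _; rewrite {2}/z linearBr /= -ip_moved_adjoint adapted_coord.
by rewrite ipZr subrr.
Qed.

Lemma adapted_dual_fixed i : d i = 0 -> g (f' i) = f' i.
Proof.
move=> di; apply/act_fixedV/esym/eqP.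
by rewrite -subr_eq0 adapted_dual di scale0r.
Qed.

Lemma fixed_coordP y : g y = y <-> forall i, d i != 0 -> ip y (e' i) = 0.
Proof.
split=> [gy i di|y0].
  have := adapted_coord y i; rewrite gy subrr linear0l => /esym/eqP.
  by rewrite mulf_eq0 intr_eq0 (negPf di) => /eqP.
apply/esym/eqP; rewrite -subr_eq0 (dual_bases_expand ff' (y - g y)).
rewrite big1// => i _; rewrite adapted_coord.
by have [->|/y0->] := eqVneq (d i) 0; rewrite ?mul0r ?mulr0 scale0r.
Qed.

Lemma moved_lattice_coordP y :
  y - g y \in L <-> forall i, (d i)%:~R * ip y (e' i) \is a Num.int.
Proof.
rewrite (dual_bases_L ff').
by split=> yi i; have := yi i; rewrite adapted_coord.
Qed.

Lemma fixed_mod_lattice_coordP y : (exists2 z, g z = z & y - z \in L) <->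
  forall i, d i != 0 -> ip y (e' i) \is a Num.int.
Proof.
split=> [[z /fixed_coordP z0 /(dual_bases_L ee') yz] i di|yi].
  by have := yz i; rewrite linearBl/= z0// subr0.
(* The part of [y] along the fixed vectors among the [e i]. *)
pose z := \sum_i (if d i == 0 then ip y (e' i) else 0) *: e i.
have ze i : ip z (e' i) = if d i == 0 then ip y (e' i) else 0.
  exact: (dual_bases_coord _ _ ee').
exists z; first by apply/fixed_coordP => i di; rewrite ze (negPf di).
apply/(dual_bases_L ee') => i; rewrite linearBl/= ze.
by case: ifPn => di; rewrite ?subrr ?rpred0// subr0 yi.
Qed.

Lemma moved_coord0 x i : x \in moved_space rho w -> d i = 0 -> ip x (e i) = 0.
Proof.
move=> /moved_spaceP + di; apply; apply/fixed_coordP => j dj.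
rewrite (dual_basesE ee'); case: eqP => // ij.
by rewrite -ij di eqxx in dj.
Qed.

(** Orthogonality to the fixed vectors [f'_i], for [d_i = 0], is what makes the
    coordinates of [x] divisible by the [d_i]. *)
Lemma moved_spaceE x : x \in moved_space rho w -> exists u, x = u - g u.
Proof.
move=> xm.
(* The terms with [d i = 0] vanish, since [0^-1 = 0]. *)
exists (\sum_i (ip x (f' i) / (d i)%:~R) *: e i).
rewrite linear_sum -sumrB {1}(dual_bases_expand ff' x).
apply: eq_bigr => i _; rewrite linearZ -scalerBr (adaptedE adapted) scalerA.
congr (_ *: _); have [di|di] := eqVneq (d i) 0; last by rewrite divfK ?intr_eq0.
rewrite di mulr0.
by have /moved_spaceP -> // := xm; apply: adapted_dual_fixed.
Qed.

Lemma act_M x : (g x \in M) = (x \in M).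
Proof.
have ME := dual_bases_dual ee'; rewrite !ME; apply/idP/idP.
  by move=> /(act_dual_lattice rho w^-1%g); rewrite actK.
exact: act_dual_lattice.
Qed.

Lemma act_L x : (g x \in L) = (x \in L).
Proof.
apply/idP/idP => [/(act_lattice rho w^-1%g)|/(act_lattice rho w)//].
by rewrite actK.
Qed.

(** Multiplying [(1 - g^-1) f'_i = d_i e'_i] by [- g] gives
    [(1 - g) f'_i = d_i (- g e'_i)], and the isometry [- g], which preserves
    both lattices, carries dual bases to dual bases. *)
Lemma adapted_bases_dual :
  adapted_bases ip g M L d f' (fun i => - g (e' i)) f (fun i => - g (e i)).
Proof.
split.
- exact: dual_bases_sym ff'.
- have [e'e xE xM xL] := dual_bases_sym ee'.
  have ipN x y : ip x (- g y) = ip (- gV x) y.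
    by rewrite linearNr linearNl /= ipC ip_act_adjoint ipC.
  split=> [i j|x|x|x].
  + rewrite linearNr linearNl opprK /= -e'e; exact: act_isometry.
  + rewrite -{1}[x]opprK -{1}[- x]actVK [gV _]xE linear_sum -sumrN.
    by apply: eq_bigr => i _; rewrite linearZ scalerN linearN ipN.
  + rewrite -(actVK x) act_M actVK -rpredN xM.
    by split=> xi i; have := xi i; rewrite ipN.
  + rewrite -(actVK x) act_L actVK -rpredN xL.
    by split=> xi i; have := xi i; rewrite ipN.
- by move=> i; rewrite scalerN -linearZ -adapted_dual linearB /= actVK opprB.
Qed.

End Coordinates.
End AdaptedCoordinates.

(** * The identity component of the fixed points *)

Section TorusTopology.
Variables (R : realType) (t : vectType R) (ip : {dot t for idfun}).

(** Linear forms are continuous. The estimate comes from the nonnegativity of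
    the norms of [u - s a] and [u + s a] for a suitable scale [s], without
    square roots. *)
Lemma ip_small (a : t) (r : R) : 0 < r ->
  exists2 eps, 0 < eps & forall u, ip u u < eps -> `|ip u a| < r.
Proof.
move=> r0.
have ip_ge0 x : 0 <= ip x x.
  have [->|/(neq0_dnorm_gt0 (s := ip))/ltW//] := eqVneq x 0.
  by rewrite linear0l.
have c0 := ip_ge0 a; pose c := ip a a + 1; pose s := r / c.
have cp : 0 < c by rewrite /c; lra.
have s0 : 0 < s by rewrite divr_gt0.
have sc : s * c = r by rewrite /s divfK// gt_eqF.
exists (r * s); first by rewrite mulr_gt0.
move=> u us.
have E (k : R) : ip (u - k *: a) (u - k *: a) =
    ip u u - 2 * k * ip u a + k ^+ 2 * ip a a.
  rewrite linearBl !linearBr /= !ipZl !ipZr (ipC ip a u); ring.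
have h1 := ip_ge0 (u - s *: a); have h2 := ip_ge0 (u - (- s) *: a).
rewrite !E in h1 h2.
have h3 : s ^+ 2 * ip a a <= s * r by rewrite -sc /c; nra.
rewrite ltr_norml; apply/andP; split; nra.
Qed.

Variable L : zmodClosed t.
Local Notation T := (torus ip L).

Lemma torus_line_continuous (z : t) :
  continuous (fun s : R => \pi_T (s *: z) : T).
Proof.
apply/continuousP => A oA.
have {}oA : euclid_open (\pi_T @^-1` A : set (euclid ip)) := oA.
rewrite openE => s /oA[eps eps0 epsA]; apply/nbhs_ballP.
pose c := ip z z + 1.
have c1 : 1 <= c.
  rewrite /c; have [->|/(neq0_dnorm_gt0 (s := ip))] := eqVneq z 0; last lra.
  by rewrite linear0l add0r.
exists (Order.min 1 (eps / c)) => /=.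
  by rewrite lt_min ltr01 divr_gt0//; lra.
move=> r; rewrite /ball/= lt_min => /andP[r1 r2]; apply: epsA.
rewrite -scalerBl ipZl ipZr; rewrite distrC in r1 r2.
rewrite ltr_pdivlMr in r2; last lra.
have n0 := normr_ge0 (r - s).
have -> : (r - s) * ((r - s) * ip z z) = `|r - s| ^+ 2 * ip z z.
  by rewrite real_normK ?num_real//; ring.
have cE : ip z z = c - 1 by rewrite /c; ring.
rewrite cE; nra.
Qed.

(** The real part of the character of the torus attached to [a]; it is well
    defined when [a] is in the dual lattice. *)
Definition torus_cos (a : t) (X : T) : R := cos (2 * pi * ip (repr X) a).

Lemma torus_cosE (a : t) (y : t) : a \in dual_lattice ip L ->
  torus_cos a (\pi_T y) = cos (2 * pi * ip y a).
Proof.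
move=> /asboolP aL.
suff [] : e2pi (ip (repr (\pi_T y : T)) a) = e2pi (ip y a) by [].
apply/e2pi_eq; rewrite -ipBl ipC; apply: aL.
by apply/(torus_eqP ip); rewrite reprK.
Qed.

Lemma torus_cos_continuous (a : t) : a \in dual_lattice ip L ->
  continuous (torus_cos a).
Proof.
move=> aL; apply/continuousP => A oA.
suff : euclid_open [set x : euclid ip | A (torus_cos a (\pi_T x))] by [].
move=> x; rewrite /= torus_cosE// => Ax.
have : nbhs (ip x a) [set r | A (cos (2 * pi * r))].
  have ct : continuous (fun r : R => cos (2 * pi * r)).
    move=> r; apply: continuous_comp; last exact: continuous_cos.
    exact: mulrl_continuous.
  by apply: ct; move: oA; rewrite openE; apply.
move=> /nbhs_ballP[r /= r0 rA].
have [eps eps0 epsr] := ip_small a r0.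
exists eps => // y /epsr yx; rewrite torus_cosE//; apply: rA.
by rewrite /ball/= -normrN opprB -ipBl.
Qed.

End TorusTopology.

Section IdentityComponent.
Variables (R : realType) (t : vectType R) (ip : {dot t for idfun}).
Variables (L M : zmodClosed t) (W : finGroupType) (rho : lattice_action ip L W).
Variable w : W.
Local Notation g := (rho w).
Local Notation T := (torus ip L).

Lemma fixedP (y : t) : \pi_T y \in fixed rho w <-> y - g y \in L.
Proof.
rewrite -rpredN opprB; split=> [/is_fixedP|/(torus_eqP ip) yE].
  by rewrite torus_actE => /torus_eqP.
by apply/is_fixedP; rewrite torus_actE.
Qed.

(** The image of a line of fixed vectors is connected. *)
Lemma fixed_vector_identity_component (z : t) : g z = z ->
  connected_component [set Y : T | Y \in fixed rho w] 0 (\pi_T z).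
Proof.
move=> gz; pose B : set T := range (fun s : R => \pi_T (s *: z)).
suff BC : B `<=` connected_component [set Y : T | Y \in fixed rho w] 0.
  by apply: BC; exists 1 => //; rewrite scale1r.
apply: connected_component_max.
- by exists 0 => //; rewrite scale0r; exact: pi_zeror.
- by move=> _ [s _ <-] /=; apply/fixedP; rewrite linearZ /= gz subrr rpred0.
- apply: connected_continuous_connected; last first.
    by apply: continuous_subspaceT; exact: torus_line_continuous.
  by apply/connected_intervalP.
Qed.

Section Coordinates.
Variables (n : nat) (d : 'I_n -> int) (e f e' f' : 'I_n -> t).
Hypothesis adapted : adapted_bases ip g L M d e f e' f'.

(** On the fixed points of the torus the character attached to [e'_i] takes
    values in the [d_i]-th roots of unity. Its real part is continuous with
    finitely many values, hence constant on connected subsets, and it is 1 at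
    the origin. *)
Lemma identity_component_coord (y : t) i :
  connected_component [set Y : T | Y \in fixed rho w] 0 (\pi_T y) ->
  d i != 0 -> ip y (e' i) \is a Num.int.
Proof.
set C := connected_component _ _ => Cy di.
have ee' := adapted_ee' adapted.
have eL : e' i \in dual_lattice ip L.
  rewrite -(dual_bases_dual ee'); apply/(dual_bases_M ee') => j.
  by rewrite ipC (dual_basesE ee') rpred_nat.
have A0 : [set Y : T | Y \in fixed rho w] 0 by exact: (rpred0 (fixed rho w)).
have dR : (d i)%:~R != 0 :> R by rewrite intr_eq0.
pose v (k : 'I_(`|d i|%N)) := cos (2 * pi * (k%:R / (d i)%:~R)) : R.
have /connected_intervalP itvJ : connected (torus_cos (e' i) @` C).
  apply: connected_continuous_connected; first exact: component_connected.
  exact/continuous_subspaceT/torus_cos_continuous.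
have vJ x : (torus_cos (e' i) @` C) x -> exists k, x = v k.
  move=> [X /connected_component_sub /= + <-]; rewrite -[X]reprK.
  move: (repr X) => u /fixedP /(moved_lattice_coordP adapted) /(_ i).
  move=> /intrP[m mE]; rewrite torus_cosE//.
  have km : (`|(m %% d i)%Z| < `|d i|)%N.
    by rewrite -ltz_nat gez0_abs ?modz_ge0// ltz_mod.
  (* The value depends only on the residue of [m] modulo [d i]. *)
  exists (Ordinal km); rewrite /v /=.
  suff [] : e2pi (ip u (e' i)) = e2pi (`|(m %% d i)%Z|%:R / (d i)%:~R) by [].
  apply/e2pi_eq.
  have -> : `|(m %% d i)%Z|%:R = (m %% d i)%Z%:~R :> R.
    by rewrite -[in RHS](gez0_abs (modz_ge0 m di)).
  have -> : ip u (e' i) = m%:~R / (d i)%:~R by rewrite -mE mulrAC divff ?mul1r.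
  have -> : m = (m %/ d i)%Z * d i + (m %% d i)%Z := divz_eq m (d i).
  rewrite modzMDl modz_mod intrD mulrDl addrK intrM mulfK//.
apply: cos_eq1; rewrite -(@torus_cosE _ _ ip L)//.
have -> : 1 = torus_cos (e' i) (0 : T).
  have -> : (0 : T) = \pi_T (0 : t) by apply/esym; exact: pi_zeror.
  by rewrite torus_cosE// linear0l mulr0 cos0.
apply: (interval_finite_eq itvJ vJ); first by exists (\pi_T y).
by exists 0 => //; apply: connected_component_refl.
Qed.

Lemma identity_componentP (X : fixed_torus rho w) (y : t) : \pi_T y = val X ->
  X \in identity_component rho w <-> exists2 z, g z = z & y - z \in L.
Proof.
move=> yX; split=> [/asboolP|[z gz yz]].
  rewrite -yX => Cy; apply/(fixed_mod_lattice_coordP adapted) => i.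
  exact: identity_component_coord.
apply/asboolP; rewrite -yX.
by have /(torus_eqP ip) -> := yz; exact: fixed_vector_identity_component.
Qed.

End Coordinates.
End IdentityComponent.

(** * Characters of the component group *)

Section PontryaginDualTheory.
Variables (R : realType) (A : zmodType).

Lemma char_pdual0 (lam : pdual R A) : lam 0 = 1.
Proof.
by apply: (mulfI (char_neq0 lam 0)); rewrite mulr1 -charD addr0.
Qed.

Lemma char_pdualB (lam : pdual R A) a b : lam (a - b) = lam a / lam b.
Proof. by rewrite -[in RHS](subrK b a) charD mulfK ?char_neq0. Qed.

End PontryaginDualTheory.

Section DualMap.
Variables (R : realType) (A B : zmodType) (f : {additive A -> B}).

Lemma pdual_map_subproof (lam : pdual R B) :
  {morph (fun a => lam (f a)) : a b / a + b >-> a * b}.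
Proof. by move=> a b; rewrite raddfD charD. Qed.

Definition pdual_map (lam : pdual R B) : pdual R A :=
  Character (fun a => char_norm1 lam (f a)) (pdual_map_subproof lam).

Lemma pdual_map_zmod_morphism : zmod_morphism pdual_map.
Proof. by move=> lam mu; apply: pdualP. Qed.

HB.instance Definition _ :=
  GRing.isZmodMorphism.Build (pdual R B) (pdual R A) pdual_map
    pdual_map_zmod_morphism.

End DualMap.

Lemma pdual_map_bij (R : realType) (A B : zmodType) (f : {additive A -> B}) :
  bijective f -> bijective (@pdual_map R A B f).
Proof.
move=> [h fK hK].
have hB : zmod_morphism h by move=> x y; rewrite -[x]hK -[y]hK -raddfB !fK.
pose H : {additive B -> A} := HB.pack h (GRing.isZmodMorphism.Build B A h hB).
by exists (@pdual_map R B A H) => lam; apply: pdualP => a /=; rewrite ?hK ?fK.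
Qed.

Section ComponentClasses.
Variables (R : realType) (t : vectType R) (ip : {dot t for idfun}).
Variables (L M : zmodClosed t) (W : finGroupType) (rho : lattice_action ip L W).
Variable w : W.
Local Notation g := (rho w).
Local Notation T := (torus ip L).
Local Notation F := (comp_group rho w).
Local Notation gV := (rho w^-1%g).

(** The subgroup of [t] lying over the fixed points of the torus. *)
Definition in_fixed_lift : {pred t} := fun y => y - g y \in L.

Lemma in_fixed_lift_zmod : zmod_closed in_fixed_lift.
Proof.
have E x : (x \in in_fixed_lift) = (x - g x \in L) by [].
split=> [|x y]; rewrite !E; first by rewrite linear0 subrr rpred0.
by move=> xL yL; rewrite linearB opprD addrACA -opprD rpredB.
Qed.

Definition fixed_lift : zmodClosed t :=
  HB.pack in_fixed_lift (GRing.isZmodClosed.Build t _ in_fixed_lift_zmod).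

Lemma fixed_liftE y : (y \in fixed_lift) = (y - g y \in L).
Proof. by []. Qed.

(** Meaningful on [fixed_lift]; made total by the default of [insubd], so that
    [induced_iso] applies to it. *)
Definition component (y : t) : F :=
  \pi_F (insubd (0 : fixed_torus rho w) (\pi_T y)).

Lemma component_pi (X : fixed_torus rho w) y :
  \pi_T y = val X -> component y = \pi_F X.
Proof. by move=> yX; rewrite /component yX valKd. Qed.

Lemma fixed_lift_torus y : y \in fixed_lift ->
  exists X : fixed_torus rho w, \pi_T y = val X.
Proof.
rewrite fixed_liftE => /fixedP yX.
by exists (exist (fun X : T => X \in fixed rho w) _ yX).
Qed.

Lemma component_surj c : exists2 y, y \in fixed_lift & component y = c.
Proof.
rewrite -[c]reprK; move: (repr c) => X.
exists (repr (val X)); last by apply: component_pi; rewrite reprK.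
by rewrite fixed_liftE; apply/fixedP; rewrite reprK; exact: valP.
Qed.

Lemma componentB : {in fixed_lift &, {morph component : x y / x - y}}.
Proof.
move=> x y /fixed_lift_torus[X xX] /fixed_lift_torus[Y yY].
rewrite (component_pi xX) (component_pi yY) (@component_pi (X - Y)).
  exact: (raddfB (\pi_F : {additive fixed_torus rho w -> F})).
rewrite torus_piB xX yY; apply/esym.
exact: (raddfB (val : {additive fixed_torus rho w -> T})).
Qed.

Lemma restricts_toP (x : t) (lam : pdual R F) : restricts_to x lam <->
  forall y, y \in fixed_lift -> lam (component y) = e2pi (ip x y).
Proof.
split=> [xlam y /fixed_lift_torus[X yX]|xlam X y yX].
  by rewrite (component_pi yX); apply: xlam.
rewrite -(component_pi yX); apply: xlam.
by rewrite fixed_liftE; apply/fixedP; rewrite yX; exact: valP.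
Qed.

Lemma restricts_to_inj (x : t) (lam mu : pdual R F) :
  restricts_to x lam -> restricts_to x mu -> lam = mu.
Proof.
move=> /restricts_toP xlam /restricts_toP xmu; apply: pdualP => c.
by have [y yN <-] := component_surj c; rewrite xlam ?xmu.
Qed.

Lemma restricts_toB (x y : t) (lam mu : pdual R F) :
  restricts_to x lam -> restricts_to y mu -> restricts_to (x - y) (lam - mu).
Proof.
move=> xlam ymu X z zX /=.
by rewrite (xlam X z zX) (ymu X z zX) ipBl e2piD e2piN.
Qed.

Section Coordinates.
Variables (n : nat) (d : 'I_n -> int) (e f e' f' : 'I_n -> t).
Hypothesis adapted : adapted_bases ip g L M d e f e' f'.
Let ee' := adapted_ee' adapted.
Let ff' := adapted_ff' adapted.

Lemma component_eq0 y : y \in fixed_lift ->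
  component y = 0 <-> exists2 z, g z = z & y - z \in L.
Proof.
move=> /fixed_lift_torus[X yX]; rewrite (component_pi yX).
rewrite -(identity_componentP adapted yX) -{2}[X]subr0 Quotient.idealrBE.
rewrite (_ : (0 : F) = \pi_F 0); first by split=> /eqP.
by apply/esym; exact: (raddf0 (\pi_F : {additive fixed_torus rho w -> F})).
Qed.

(** This is what makes the restriction of a character of the torus factor
    through the component group. *)
Lemma moved_ip_int x y : x \in moved_space rho w -> x \in M ->
  (exists2 z, g z = z & y - z \in L) -> ip x y \is a Num.int.
Proof.
move=> /moved_spaceP xm xM [z gz yz].
rewrite -(subrK z y) linearDr /= (xm z gz) addr0.
by move: xM; rewrite (dual_bases_dual ee') => /asboolP; apply.
Qed.

Lemma restricts_to_exists x : x \in moved_space rho w -> x \in M ->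
  exists lam : pdual R F, restricts_to x lam.
Proof.
move=> xm xM.
have wd y z : y \in fixed_lift -> z \in fixed_lift ->
    component y = component z -> e2pi (ip x y) = e2pi (ip x z).
  move=> yN zN /eqP; rewrite -subr_eq0 -componentB// => /eqP yz.
  apply/e2pi_eq; rewrite -ipBr; apply: moved_ip_int => //.
  by apply/component_eq0; rewrite // rpredB.
pose s c := projT1 (cid2 (component_surj c)).
have sN c : s c \in fixed_lift by rewrite /s; case: cid2.
have sK c : component (s c) = c by rewrite /s; case: cid2.
pose lam c := e2pi (ip x (s c)).
have lamB a b : lam (a - b) = lam a / lam b.
  rewrite /lam -e2piN -e2piD -ipBr; apply: wd; rewrite ?rpredB//.
  by rewrite componentB// !sK.
have lam_nz c : lam c != 0 by rewrite -normr_eq0 e2pi_norm1 oner_eq0.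
have lamD : {morph lam : a b / a + b >-> a * b}.
  by move=> a b; rewrite -[in RHS](addrK b a) lamB divfK.
exists (Character (fun c => e2pi_norm1 (ip x (s c))) lamD).
by apply/restricts_toP => y yN; apply: wd; rewrite ?sK.
Qed.

Lemma component_fixed_eq0 z : g z = z -> component z = 0.
Proof.
move=> gz; apply/component_eq0; first by rewrite fixed_liftE gz subrr rpred0.
by exists z; rewrite // subrr rpred0.
Qed.

Lemma component_lattice_eq0 l : l \in L -> component l = 0.
Proof.
move=> lL; apply/component_eq0; first by rewrite fixed_liftE rpredB ?act_L.
by exists 0; [exact: linear0|rewrite subr0].
Qed.

(** A character of the component group is the restriction attached to [x] as
    soon as [agree] holds on generators of [fixed_lift], because it defines a
    subgroup. *)
Definition agree (lam : pdual R F) (x : t) : {pred t} :=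
  fun y => (y \in fixed_lift) && (lam (component y) == e2pi (ip x y)).

Lemma agree_zmod lam x : zmod_closed (agree lam x).
Proof.
split=> [|y z /andP[yN /eqP yE] /andP[zN /eqP zE]]; apply/andP; split.
- exact: rpred0.
- by rewrite component_fixed_eq0 ?linear0// char_pdual0 e2pi0.
- exact: rpredB.
- by rewrite componentB// char_pdualB yE zE ipBr e2piD e2piN.
Qed.

Let u i := (d i)%:~R^-1 *: e i.

(** Together with the fixed vectors, these vectors generate [fixed_lift]; they
    are 0 when [d i = 0]. *)
Lemma torsion_lift i : u i \in fixed_lift.
Proof.
rewrite fixed_liftE; apply/(moved_lattice_coordP adapted) => j.
rewrite ipZl (dual_basesE ee').
have [->|_] := eqVneq i j; last by rewrite !mulr0 rpred0.
have [->|dj] := eqVneq (d j) 0; first by rewrite mul0r rpred0.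
by rewrite mulr1 divff ?intr_eq0// rpred1.
Qed.

(** The value of [lam] on the class of [e_i / d_i] is [e2pi (th i)], which
    prescribes the coordinates [d_i th_i] of [x]. They are integers because
    [d_i] times that class is the class of [e_i], which is trivial. *)
Lemma restricts_to_surj (lam : pdual R F) : exists x,
  [/\ x \in moved_space rho w, x \in M & restricts_to x lam].
Proof.
have theta i : exists a : R, lam (component (u i)) = e2pi a.
  by apply: e2pi_surj; apply: char_norm1.
pose th i := projT1 (cid (theta i)).
have thE i : lam (component (u i)) = e2pi (th i) by rewrite /th; case: cid.
pose x := \sum_i ((d i)%:~R * th i) *: e' i.
have xe i : ip x (e i) = (d i)%:~R * th i.
  exact: (dual_bases_coord _ _ (dual_bases_sym ee')).
have dR i : d i != 0 -> (d i)%:~R != 0 :> R by rewrite intr_eq0.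
pose K : zmodClosed t :=
  HB.pack (agree lam x) (GRing.isZmodClosed.Build t _ (agree_zmod lam x)).
have uK i : d i != 0 -> u i \in K.
  move=> di; apply/andP; split; first exact: torsion_lift.
  by rewrite ipZr xe mulKf ?dR// thE.
have xm : x \in moved_space rho w.
  apply/moved_spaceP => z /(fixed_coordP adapted) z0.
  rewrite (dual_bases_ip ee') big1// => i _; rewrite xe.
  by have [->|/z0->] := eqVneq (d i) 0; rewrite ?mul0r ?mulr0.
exists x; split => //.
  apply/(dual_bases_M ee') => i.
  have [di|di] := eqVneq (d i) 0; first by rewrite xe di mul0r rpred0.
  have : e i \in K.
    rewrite (_ : e i = u i *~ d i) ?rpredMz ?uK//.
    by rewrite -scaler_int scalerA divff ?dR// scale1r.
  move=> /andP[_]; rewrite component_lattice_eq0 ?char_pdual0; last first.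
    by apply/(dual_bases_L ee') => j; rewrite (dual_basesE ee') rpred_nat.
  by move=> /eqP/esym/e2pi_eq1.
apply/restricts_toP => y yN; suff /andP[_ /eqP//] : y \in K.
have /(moved_lattice_coordP adapted) yd := yN.
(* Subtracting [v] from [y] leaves a fixed vector. *)
pose v := \sum_i (if d i == 0 then 0 else ip y (e' i)) *: e i.
have gz : g (y - v) = y - v.
  apply/(fixed_coordP adapted) => i di.
  by rewrite ipBl (dual_bases_coord _ _ ee') (negPf di) subrr.
rewrite -(subrK v y) rpredD//.
  apply/andP; split; first by rewrite fixed_liftE gz subrr rpred0.
  rewrite component_fixed_eq0// char_pdual0.
  by have /moved_spaceP -> // := xm; rewrite e2pi0.
apply: rpred_sum => i _.
case: eqVneq => [_|di]; first by rewrite scale0r rpred0.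
have /intrP[k kE] := yd i.
rewrite (_ : _ *: e i = u i *~ k) ?rpredMz ?uK//.
by rewrite -scaler_int scalerA -kE mulrAC divff ?dR// mul1r.
Qed.

(** If [x] restricts to the trivial character, then it is integral on the
    vectors [e_i / d_i], so that its coordinates are multiples of the [d_i];
    this says that [x] is the image of a lattice vector. *)
Lemma restricts_to0P x : x \in moved_space rho w -> x \in M ->
  restricts_to x (0 : pdual R F) <-> exists2 y, y \in M & x = y - g y.
Proof.
move=> xm xM; split=> [/restricts_toP x0|[y yM ->]].
  have xu i : ip x (u i) \is a Num.int.
    by apply/e2pi_eq1; rewrite -x0// torsion_lift.
  pose v := \sum_i ip x (u i) *: f' i.
  have vM : v \in M.
    apply/(dual_bases_M ff') => i.
    by rewrite (dual_bases_coord _ _ (dual_bases_sym ff')).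
  exists (- gV v); first by rewrite rpredN -(act_M adapted) actVK.
  have -> : - gV v - g (- gV v) = \sum_i (ip x (u i) * (d i)%:~R) *: e' i.
    rewrite -movedV linear_sum -sumrB; apply: eq_bigr => i _.
    by rewrite /= [gV _]linearZ -scalerBr (adapted_dual adapted) scalerA.
  rewrite {1}(dual_bases_expand (dual_bases_sym ee') x); apply: eq_bigr => i _.
  congr (_ *: _); rewrite ipZr; have [di|di] := eqVneq (d i) 0.
    by rewrite (moved_coord0 adapted xm di) di mulr0.
  by rewrite mulrAC mulVf ?mul1r// intr_eq0.
apply/restricts_toP => z zN; apply/esym/e2pi_eq1.
rewrite ip_moved_adjoint movedV linearN /= actVK opprK addrC -ipC.
rewrite fixed_liftE in zN.
move: yM; rewrite (dual_bases_dual ee') => /asboolP yM.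
rewrite ipC; apply: yM.
by rewrite -(act_L rho w) linearB /= actVK -opprB rpredN.
Qed.

Lemma restriction_identifies_adapted : restriction_identifies rho w M.
Proof.
split; [exact: restricts_to_exists|exact: restricts_to_surj|].
exact: restricts_to0P.
Qed.

End Coordinates.
End ComponentClasses.

(** * The pairing polynomial inverts 1 - g *)

Section PolynomialsOfEndomorphisms.
Variables (K : fieldType) (V : vectType K) (h : 'End(V)).
Implicit Types (p q : {poly K}) (v : V).

Lemma poly_lfun_wide k p v : (size p <= k)%N ->
  poly_lfun p h v = \sum_(i < k) p`_i *: iter i h v.
Proof.
move=> pk.
rewrite /poly_lfun (big_ord_widen _ (fun i => p`_i *: iter i h v) pk).
rewrite big_mkcond /=; apply: eq_bigr => i _; case: ltnP => // ip.
by rewrite nth_default// scale0r.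
Qed.

Lemma poly_lfunB p q v :
  poly_lfun (p - q) h v = poly_lfun p h v - poly_lfun q h v.
Proof.
pose k := maxn (size p) (size q).
have sk : (size (p - q)%R <= k)%N.
  by rewrite (leq_trans (size_polyD _ _))// size_polyN.
rewrite !(@poly_lfun_wide k) ?leq_maxl ?leq_maxr// -sumrB.
by apply: eq_bigr => i _; rewrite coefB scalerBl.
Qed.

Lemma poly_lfunC c v : poly_lfun c%:P h v = c *: v.
Proof.
by rewrite (@poly_lfun_wide 1) ?size_polyC ?leq_b1// big_ord1 coefC.
Qed.

Lemma poly_lfunMX p v : poly_lfun (p * 'X) h v = poly_lfun p h (h v).
Proof.
have sk : (size (p * 'X)%R <= (size p).+1)%N.
  by rewrite (leq_trans (size_polyMleq _ _))// size_polyX addn2.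
rewrite (poly_lfun_wide v sk) big_ord_recl coefMX eqxx scale0r add0r.
by apply: eq_bigr => i _; rewrite coefMX /= -iterSr.
Qed.

Lemma poly_lfunBr p v v' :
  poly_lfun p h (v - v') = poly_lfun p h v - poly_lfun p h v'.
Proof.
rewrite -sumrB; apply: eq_bigr => i _; rewrite -scalerBr; congr (_ *: _).
by elim: (i : nat) => //= k ->; rewrite linearB.
Qed.

Lemma poly_lfun_comm p v : h (poly_lfun p h v) = poly_lfun p h (h v).
Proof.
by rewrite linear_sum; apply: eq_bigr => i _; rewrite linearZ /= -iterSr.
Qed.

Lemma poly_dotE p : p - p.[1]%:P = poly_dot p * ('X - 1%:P).
Proof. by rewrite divpK// dvdp_XsubCl rootE !hornerE subrr. Qed.

(** The division of [p - p.[1]] by ['X - 1], evaluated at [h]. *)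
Lemma poly_lfun_dot p v :
  poly_lfun p h v = p.[1] *: v - poly_lfun (poly_dot p) h (v - h v).
Proof.
have := congr1 (fun q => poly_lfun q h v) (poly_dotE p).
rewrite mulrBr mulr1 !poly_lfunB poly_lfunMX poly_lfunC => pE.
by rewrite poly_lfunBr opprB -pE addrC subrK.
Qed.

End PolynomialsOfEndomorphisms.

Section PairingInverse.
Variables (R : realType) (t : vectType R) (ip : {dot t for idfun}).
Variables (L : zmodClosed t) (W : finGroupType) (rho : lattice_action ip L W).
Variable w : W.
Local Notation g := (rho w).
Let m := lfun_minpoly g.

(** An isometry is semisimple at the eigenvalue 1, because the image of [1 - g]
    is orthogonal to the fixed space: if the square of ['X - 1] divided [m],
    the values of [m / ('X - 1)] at [g] would be fixed vectors in that image,
    hence 0, against the minimality of [m]. *)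
Lemma simple_root1 : m.[1] = 0 -> (poly_dot m).[1] != 0.
Proof.
have [m_monic mg m_min] := lfun_minpolyP g; rewrite -/m in m_monic mg m_min.
move=> m1; apply/eqP => dm1.
have mE : m = poly_dot m * ('X - 1%:P) by rewrite -poly_dotE m1 subr0.
have dm0 v : poly_lfun (poly_dot m) g v = 0.
  pose q := poly_lfun (poly_dot (poly_dot m)) g v.
  have E : poly_lfun (poly_dot m) g v = - (q - g q).
    by rewrite poly_lfun_dot dm1 scale0r sub0r poly_lfunBr -poly_lfun_comm.
  rewrite E (@ip_eq0 _ _ ip (q - g q)) ?oppr0//.
  have /moved_spaceP := moved_space_moved rho w q; apply.
  have := mg v; rewrite poly_lfun_dot m1 scale0r sub0r poly_lfunBr.
  rewrite -poly_lfun_comm E.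
  by rewrite linearN !opprD !opprK => /eqP; rewrite subr_eq0 => /eqP/esym.
have dm_nz : poly_dot m != 0.
  apply: contraTneq m_monic => dm.
  by rewrite mE dm mul0r monicE lead_coef0 eq_sym oner_eq0.
have := dvdp_leq dm_nz (m_min _ dm0).
by rewrite {1}mE size_Mmonic ?monicXsubC// size_XsubC addn2 ltnn.
Qed.

(** On the image of [1 - g] the evaluated pairing polynomial, divided by its
    scale, inverts [1 - g]. If 1 is not a root of [m], this is
    [m(1) = (1 - g) (poly_dot m)(g)]. If it is, then [poly_dot m] annihilates
    that image, and the same identity for [poly_dot m] is used. *)
Lemma pairing_inverse v :
  let y := v - g v in
  let u := (pairing_scale rho w)^-1 *: poly_lfun (pairing_poly rho w) g y in
  u - g u = y.
Proof.
move=> y u.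
have [_ mg _] := lfun_minpolyP g; rewrite -/m in mg.
suff [s0 sE] : pairing_scale rho w != 0 /\
    poly_lfun (pairing_poly rho w) g (y - g y) = pairing_scale rho w *: y.
  rewrite /u linearZ -scalerBr /= poly_lfun_comm -poly_lfunBr sE scalerA.
  by rewrite mulVf// scale1r.
rewrite /pairing_scale /pairing_poly -/m; case: ifPn => m1.
  split; first exact: simple_root1 (eqP m1).
  have : poly_lfun (poly_dot m) g y = 0.
    have := mg v; rewrite poly_lfun_dot (eqP m1) scale0r sub0r -/y.
    by move/eqP; rewrite oppr_eq0 => /eqP.
  by rewrite poly_lfun_dot => /eqP; rewrite subr_eq0 => /eqP <-.
split=> //; have := mg y; rewrite poly_lfun_dot => /eqP.
by rewrite subr_eq0 => /eqP <-.
Qed.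

End PairingInverse.

(** * Duality of the component groups *)

Lemma subr_swap (V : zmodType) (a b c d : V) : a - b = c - d -> a - c = b - d.
Proof.
by move=> ab; rewrite -(subrK b a) ab -!addrA addrC -!addrA addNr addr0 addrC.
Qed.

Section Duality.
Variables (R : realType) (t : vectType R) (ip : {dot t for idfun}).
Variables (L : zmodClosed t) (W : finGroupType) (rho : lattice_action ip L W).
Variable w : W.
Local Notation g := (rho w).
Local Notation gV := (rho w^-1%g).
Local Notation LV := (dual_lattice ip L).
Local Notation rhoV := (dual_action rho).
Local Notation F := (comp_group rho w).
Local Notation FV := (comp_group rhoV w).
Variables (n : nat) (d : 'I_n -> int) (e f e' f' : 'I_n -> t).
Hypothesis adapted : adapted_bases ip g L LV d e f e' f'.
Let ee' := adapted_ee' adapted.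
Let ff' := adapted_ff' adapted.
Let adaptedV : adapted_bases ip (rhoV w) LV L d f' (fun i => - g (e' i)) f
  (fun i => - g (e i)) := adapted_bases_dual adapted.

Lemma restriction_identifies_dual : restriction_identifies rhoV w L.
Proof. exact: restriction_identifies_adapted adaptedV. Qed.

(** Since [L] and its dual have adapted bases with the same [d], the linear map
    [S] sending [f'_i] to [e_i] matches the conditions on coordinates that
    define the two component groups. *)
Lemma comp_group_iso : exists psi : {additive FV -> F}, bijective psi.
Proof.
pose S v := \sum_i ip v (f i) *: e i.
have SB : {morph S : x y / x - y}.
  by move=> x y; rewrite -sumrB; apply: eq_bigr => i _; rewrite ipBl scalerBl.
have Se v i : ip (S v) (e' i) = ip v (f i) by exact: (dual_bases_coord _ _ ee').
have SN v : (S v \in fixed_lift rho w) <-> (v \in fixed_lift rhoV w).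
  rewrite !fixed_liftE (moved_lattice_coordP adapted).
  rewrite (moved_lattice_coordP adaptedV).
  by split=> vi i; have := vi i; rewrite Se.
have S_surj y : exists v, S v = y.
  exists (\sum_i ip y (e' i) *: f' i).
  rewrite [RHS](dual_bases_expand ee'); apply: eq_bigr => i _.
  by rewrite (dual_bases_coord _ _ (dual_bases_sym ff')).
have [||||v vN|psi psi_bij _] := @induced_iso t FV F (fixed_lift rhoV w)
    (component rhoV w) (fun v => component rho w (S v)).
- exact: componentB.
- by move=> x y xN yN; rewrite SB componentB//; apply/SN.
- exact: component_surj.
- move=> c; have [y yN yc] := component_surj c; have [v vy] := S_surj y.
  by exists v; rewrite ?vy//; apply/SN; rewrite vy.
- rewrite (component_eq0 adaptedV)// (component_eq0 adapted) ?(SN v)//.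
  rewrite (fixed_mod_lattice_coordP adapted).
  rewrite (fixed_mod_lattice_coordP adaptedV).
  by split=> vi i di; have := vi i di; rewrite Se.
- by exists psi.
Qed.

(** Made total by a default value, so that [induced_iso] applies to it. *)
Definition char_of (L0 : zmodClosed t) (rho0 : lattice_action ip L0 W) (x : t) :
  pdual R (comp_group rho0 w) := xget 0 [set lam | restricts_to x lam].

Lemma moved_dual v : v \in fixed_lift rhoV w ->
  v - gV v \in moved_space rho w /\ v - gV v \in LV.
Proof.
rewrite fixed_liftE => vN; split; first by rewrite movedV moved_space_moved.
have -> : v - gV v = - gV (v - g v) by rewrite linearB /= actK opprB.
by rewrite rpredN; apply: act_dual_lattice.
Qed.

(** Both isomorphisms come from [induced_iso] applied to vectors of [t]: the
    character attached to [(1 - g) u] is trivial exactly when [(1 - g) u] lies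
    in [(1 - g) L], that is, when [u] is a fixed vector up to [L], that is,
    when the component of [u] is trivial; and likewise for [1 - g^-1] on the
    dual side. *)
Lemma component_duality :
  exists (kappa : {additive pdual R FV -> F})
    (phi : {additive FV -> pdual R F}),
  [/\ bijective kappa, bijective phi,
      (forall u psi, u \in fixed_lift rho w -> restricts_to (u - g u) psi ->
         kappa psi = component rho w u)
    & forall v, v \in fixed_lift rhoV w ->
        restricts_to (v - gV v) (phi (component rhoV w v))].
Proof.
have [rE rS r0] := restriction_identifies_adapted adapted.
have [rVE rVS rV0] := restriction_identifies_adapted adaptedV.
have chi_u u : u \in fixed_lift rho w ->
    restricts_to (u - g u) (char_of rhoV (u - g u)).
  rewrite fixed_liftE => uN.
  apply: (@xgetPex _ 0 [set lam | restricts_to _ lam]).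
  by apply: rVE => //; exact: (moved_space_moved rhoV).
have chi_v v : v \in fixed_lift rhoV w ->
    restricts_to (v - gV v) (char_of rho (v - gV v)).
  move=> /moved_dual[vm vM].
  apply: (@xgetPex _ 0 [set lam | restricts_to _ lam]).
  exact: rE.
have [||psi||u uN|kappa kappa_bij kappaE] := @induced_iso t (pdual R FV) F
    (fixed_lift rho w) (fun u => char_of rhoV (u - g u)) (component rho w).
- move=> x y xN yN; apply: restricts_to_inj (chi_u _ (rpredB xN yN)) _.
  rewrite linearB opprD addrACA -opprD.
  by apply: restricts_toB; apply: chi_u.
- exact: componentB.
- have [x [xm xL xpsi]] := rVS psi.
  have [u uE] := moved_spaceE adapted xm.
  exists u; first by rewrite fixed_liftE -uE.
  apply: restricts_to_inj xpsi; rewrite uE; apply: chi_u.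
  by rewrite fixed_liftE -uE.
- exact: component_surj.
- rewrite (component_eq0 adapted uN); split=> [c0|[z gz uz]].
    have := chi_u u uN; rewrite c0 => /(rV0 _ (moved_space_moved rhoV w u) uN).
    move=> [y yL uy]; exists (u - y); last by rewrite opprB addrC subrK.
    by rewrite linearB; apply/esym/subr_swap.
  apply: restricts_to_inj (chi_u u uN) _.
  apply/(rV0 _ (moved_space_moved rhoV w u) uN).
  by exists (u - z) => //; rewrite [g (u - z)]linearB /= gz opprB addrA subrK.
have [||c|lam|v vN|phi phi_bij phiE] := @induced_iso t FV (pdual R F)
    (fixed_lift rhoV w) (component rhoV w) (fun v => char_of rho (v - gV v)).
- exact: componentB.
- move=> x y xN yN; apply: restricts_to_inj (chi_v _ (rpredB xN yN)) _.
  rewrite linearB opprD addrACA -opprD.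
  by apply: restricts_toB; apply: chi_v.
- exact: component_surj.
- have [x [xm xL xlam]] := rS lam.
  have [u uE] := moved_spaceE adapted xm.
  have uN : - g u \in fixed_lift rhoV w.
    rewrite fixed_liftE -[_ - _]opprK rpredN.
    have -> : - (- g u - g (- g u)) = g (u - g u).
      by rewrite [g (- _)]linearN [g (u - _)]linearB /= opprD !opprK.
    by apply: act_dual_lattice; rewrite -uE.
  exists (- g u) => //; apply: restricts_to_inj xlam.
  suff -> : x = - g u - gV (- g u) by apply: chi_v.
  by rewrite [gV _]linearN /= opprK actK addrC.
- have [vm vM] := moved_dual vN.
  rewrite (component_eq0 adaptedV vN); split=> [[z gz vz]|c0].
    apply: restricts_to_inj (chi_v v vN) _; apply/(r0 _ vm vM).
    exists (- gV (v - z)); first by rewrite rpredN act_dual_lattice.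
    rewrite -movedV [gV (v - z)]linearB /=; have /act_fixedV -> := gz.
    by rewrite opprB addrA subrK.
  have := chi_v v vN; rewrite c0 => /(r0 _ vm vM)[y yM vy].
  exists (v + g y); last by rewrite opprD addNKr rpredN act_dual_lattice.
  apply/act_fixedV; rewrite [gV _]linearD /= actK.
  rewrite {1}(_ : y = v - gV v + g y); last by rewrite vy subrK.
  by rewrite addrA [gV v + _]addrC subrK.
exists kappa, phi; split=> // [u psi uN upsi|v vN].
  rewrite -kappaE//; congr (kappa _).
  exact: restricts_to_inj upsi (chi_u _ uN).
by rewrite phiE//; apply: chi_v.
Qed.

End Duality.

Theorem theorem2 (R : realType) (t : vectType R) (ip : {dot t for idfun})
    (Gamma : zmodClosed t) (W : finGroupType)
    (rho : lattice_action ip Gamma W) (w : W) :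
  is_lattice Gamma ->
  [/\ restriction_identifies rho w (dual_lattice ip Gamma),
      restriction_identifies (dual_action rho) w Gamma,
      exists
        (chi : {additive pdual R (comp_group rho w) ->
                         pdual R (pdual R (comp_group (dual_action rho) w))})
        (phi : {additive comp_group (dual_action rho) w ->
                         pdual R (comp_group rho w)}),
        [/\ is_component_pairing chi, bijective chi, bijective phi
          & forall z, chi (phi z) = ev_char R z]
    & exists psi : {additive comp_group (dual_action rho) w ->
                             comp_group rho w}, bijective psi].
Proof.
move=> /adapted_bases_exist/(_ (act_lattice rho w)).
move=> /(_ ip)[n [d [e [f [e' [f' adapted]]]]]].
split.
- exact: restriction_identifies_adapted adapted.
- exact: restriction_identifies_dual adapted.
- have [kappa [phi [kappa_bij phi_bij kappaE phiE]]] :=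
    component_duality adapted.
  exists (@pdual_map R _ _ kappa), phi; split=> //.
  + move=> x y lam psi xm xL ym yL /restricts_toP xlam ypsi /=.
    have [v yE] := moved_spaceE adapted ym.
    have uy := pairing_inverse rho w v; rewrite /= -yE in uy.
    set u := _ *: _ in uy.
    have uN : u \in fixed_lift rho w by rewrite fixed_liftE uy.
    by rewrite (kappaE u psi uN) ?uy// xlam// ipZr.
  + exact: pdual_map_bij.
  + move=> z; apply: pdualP => psi /=.
    have [v vN <-] := component_surj z.
    have [_ rVS _] := restriction_identifies_dual adapted.
    have [y [ym yL ypsi]] := rVS psi.
    have [u yE] := moved_spaceE adapted ym.
    have uN : u \in fixed_lift rho w by rewrite fixed_liftE -yE.
    rewrite (kappaE u) -?yE//.
    have /restricts_toP -> // := phiE v vN.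
    have /restricts_toP -> // := ypsi.
    by rewrite yE ip_moved_adjoint ipC.
- exact: comp_group_iso adapted.
Qed.
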